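(* Let $n, m \geq 1$, and for each $j = 1,\dots,m$ let $Q_j \in \mathbb{R}^{n\times n}$ be a symmetric positive definite matrix and $x_j^f \in \mathbb{R}^n$. Then the set $$\hat{\mathcal{G}} = \Big\{(x,\alpha) \in \mathbb{R}^n \times \Delta^m \;\Big|\; \Big(\sum_{j=1}^m \alpha_j Q_j\Big) x = \sum_{j=1}^m \alpha_j Q_j x_j^f\Big\}$$ is compact.
   Context: $\Delta^m = \{\alpha \in \mathbb{R}^m \mid \alpha_i \geq 0 \text{ for all } i,\ \sum_{i=1}^m \alpha_i = 1\}$ is the probability simplex. The set $\hat{\mathcal{G}}$ is the set of pairs $(x,\alpha)$ with $\nabla_x f_\alpha(x) = 0$, where $f_\alpha = \sum_{j=1}^m \alpha_j f_j$ and $f_j(x) = \tfrac12 (x - x_j^f)^T Q_j (x - x_j^f)$. Compactness is with respect to the usual topology of $\mathbb{R}^n \times \mathbb{R}^m$. *)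

(* Defs.v *)
From mathcomp Require Import all_boot all_order all_algebra.
From mathcomp Require Import all_classical all_reals all_analysis.
Import Order.TTheory GRing.Theory Num.Theory numFieldNormedType.Exports.

Set Implicit Arguments.
Unset Strict Implicit.
Unset Printing Implicit Defensive.

Local Open Scope classical_set_scope.
Local Open Scope ring_scope.

Definition spd (R : realType) (n : nat) (Q : 'M[R]_n) : Prop :=
  Q \is symmetricmx /\
  forall v : 'cV[R]_n, v != 0 -> 0 < (v^T *m Q *m v) 0 0.

Definition simplex (R : realType) (m : nat) : set 'rV[R]_m :=
  [set a | (forall i, 0 <= a 0 i) /\ \sum_i a 0 i = 1].

Definition quadf (R : realType) (n : nat) (Q : 'M[R]_n) (c x : 'cV[R]_n) : R :=
  2^-1 * ((x - c)^T *m Q *m (x - c)) 0 0.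

Definition wsum (R : realType) (n m : nat) (Q : 'I_m -> 'M[R]_n)
    (xf : 'I_m -> 'cV[R]_n) (a : 'rV[R]_m) (x : 'cV[R]_n) : R :=
  \sum_(j < m) a 0 j * quadf (Q j) (xf j) x.

(* Vector of partial derivatives. 'D_v f x is an unconditional lim, so it is
   meaningful only where f is derivable; here it is applied to wsum Q xf a,
   a polynomial in x. *)
Definition gradient (R : realType) (n : nat) (f : 'cV[R]_n -> R)
    (x : 'cV[R]_n) : 'cV[R]_n :=
  \col_(i < n) 'D_(delta_mx i 0) f x.

Definition Ghat (R : realType) (n m : nat) (Q : 'I_m -> 'M[R]_n)
    (xf : 'I_m -> 'cV[R]_n) : set ('cV[R]_n * 'rV[R]_m) :=
  [set p | simplex p.2 /\ gradient (wsum Q xf p.2) p.1 = 0].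

(* Main.v *)
Require Import Defs.
From mathcomp Require Import all_boot all_order all_algebra.
From mathcomp Require Import all_classical all_reals all_analysis.
From mathcomp Require Import ring.
Import Order.TTheory GRing.Theory Num.Theory numFieldNormedType.Exports.

Local Open Scope classical_set_scope.
Local Open Scope ring_scope.

(** Each [f_j] is a quadratic polynomial, so the gradient condition is the
    linear system [A(a) x = b(a)] with [A(a) = \sum_j a_j Q_j]. On the simplex
    [A(a)] is positive definite, hence invertible, so [Ghat] is the image of the
    simplex under [a |-> (A(a)^-1 b(a), a)]. By Cramer's rule this map is
    continuous there, and the simplex is compact. *)

Section MatrixLimits.
Variables (K : numFieldType) (T : Type) (F : set_system T).
Context {FF : Filter F}.

(** A basic neighbourhood of [M] is a box of entrywise neighbourhoods. There are finitely many
    entries, so the filter contains the intersection of the corresponding conditions. *)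
Lemma cvg_mx (m n : nat) (f : T -> 'M[K]_(m, n)) (M : 'M[K]_(m, n)) :
  (forall i j, f t i j @[t --> F] --> M i j) -> f @ F --> M.
Proof.
move=> fM A [P MP sPA].
apply: (filterS (P := fun t => forall i j, P i j (f t i j))).
  by move=> t; exact: sPA.
apply: (filter_forall (f := fun i t => forall j, P i j (f t i j))) => i.
apply: (filter_forall (f := fun j t => P i j (f t i j))) => j.
exact: (fM i j _ (MP i j)).
Qed.

Lemma cvg_coord {m n : nat} {f : T -> 'M[K]_(m, n)} {M : 'M[K]_(m, n)} i j :
  f @ F --> M -> f t i j @[t --> F] --> M i j.
Proof.
move=> fM; apply: (cvg_comp f (fun N : 'M[K]_(m, n) => N i j) fM).
exact: coord_continuous.
Qed.

Lemma cvg_sumr (I : Type) (r : seq I) (P : pred I) (f : I -> T -> K)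
    (l : I -> K) :
  (forall i, P i -> f i @ F --> l i) ->
  \sum_(i <- r | P i) f i t @[t --> F] --> \sum_(i <- r | P i) l i.
Proof. by apply: cvg_big; exact: add_continuous. Qed.

Lemma cvg_prodr (I : Type) (r : seq I) (P : pred I) (f : I -> T -> K)
    (l : I -> K) :
  (forall i, P i -> f i @ F --> l i) ->
  \prod_(i <- r | P i) f i t @[t --> F] --> \prod_(i <- r | P i) l i.
Proof. by apply: cvg_big; exact: mul_continuous. Qed.

Lemma cvg_mulmx (m n p : nat) (f : T -> 'M[K]_(m, n)) (g : T -> 'M[K]_(n, p))
    (A : 'M[K]_(m, n)) (B : 'M[K]_(n, p)) :
  f @ F --> A -> g @ F --> B -> f t *m g t @[t --> F] --> A *m B.
Proof.
move=> fA gB; apply: cvg_mx => i k; rewrite mxE.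
under eq_cvg => t do rewrite mxE.
by apply: cvg_sumr => j _; apply: cvgM; exact: cvg_coord.
Qed.

Lemma cvg_det (n : nat) (f : T -> 'M[K]_n) (A : 'M[K]_n) :
  f @ F --> A -> \det (f t) @[t --> F] --> \det A.
Proof.
move=> fA; apply: cvg_sumr => s _; apply: cvgM; first exact: cvg_cst.
by apply: cvg_prodr => i _; exact: cvg_coord.
Qed.

Lemma cvg_adjugate (n : nat) (f : T -> 'M[K]_n) (A : 'M[K]_n) :
  f @ F --> A -> \adj (f t) @[t --> F] --> \adj A.
Proof.
move=> fA; apply: cvg_mx => i j; rewrite mxE.
under eq_cvg => t do rewrite mxE.
apply: cvgM; first exact: cvg_cst.
apply: cvg_det; apply: cvg_mx => k l; rewrite !mxE.
under eq_cvg => t do rewrite !mxE.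
exact: cvg_coord.
Qed.

(** [invmx] returns its argument on singular matrices, so Cramer's formula describes it only where
    the determinant is nonzero. Since [\det A != 0], this holds eventually along [F], and the
    formula is continuous there. *)
Lemma cvg_invmx (n : nat) (f : T -> 'M[K]_n) (A : 'M[K]_n) :
  A \in unitmx -> f @ F --> A -> invmx (f t) @[t --> F] --> invmx A.
Proof.
move=> uA fA; have dA : \det A != 0 by rewrite -unitfE.
apply: (cvg_trans (near_eq_cvg
    (f := fun t => (\det (f t))^-1 *: \adj (f t)) _)).
  have : \forall t \near F, \det (f t) != 0.
    by apply: (cvgr_neq0 (\det A)) => //; exact: cvg_det.
  by apply: filterS => t dt; rewrite /invmx unitmxE unitfE dt.
rewrite /invmx uA; apply: cvg_mx => i j; rewrite mxE.
under eq_cvg => t do rewrite mxE.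
apply: cvgM; last exact/cvg_coord/cvg_adjugate.
by apply: cvgV => //; exact: cvg_det.
Qed.

End MatrixLimits.

Section WeightedQuadratics.
Variables (R : realType) (n m : nat).
Variables (Q : 'I_m -> 'M[R]_n) (xf : 'I_m -> 'cV[R]_n).
Implicit Types (a : 'rV[R]_m) (x v : 'cV[R]_n).

Let A a := \sum_(j < m) a 0 j *: Q j.
Let b a := \sum_(j < m) a 0 j *: (Q j *m xf j).

(** [symmetricmx] is the hermitian predicate with sign exponent 0 and the identity as involution;
    both decorations simplify away. *)
Lemma symmetricmx_tr (M : 'M[R]_n) : M \is symmetricmx -> M^T = M.
Proof.
by move/is_hermitianmxP; rewrite expr0 scale1r map_mx_id // => {2}->.
Qed.

(** Taylor's expansion is exact for a quadratic. Symmetry makes the two cross terms equal, which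
    absorbs the factor 1/2. *)
Lemma quadf_shift (M : 'M[R]_n) (c x v : 'cV[R]_n) (h : R) :
  M \is symmetricmx ->
  quadf M c (h *: v + x) =
    quadf M c x + h * (v^T *m M *m (x - c)) 0 0 + h ^+ 2 * quadf M 0 v.
Proof.
move=> /symmetricmx_tr sM; rewrite /quadf subr0 -[_ + x - c]addrA.
move: (x - c) => y.
(* A 1x1 matrix equals its own transpose. *)
have yv : (y^T *m M *m v) 0 0 = (v^T *m M *m y) 0 0.
  by rewrite -[LHS](mxE trmx_key (fun i j => (y^T *m M *m v) j i)) -/(trmx _)
    !trmx_mul trmxK sM mulmxA.
have -> : (h *: v + y)^T = h *: v^T + y^T.
  by apply/matrixP => i j; rewrite !mxE.
rewrite !mulmxDl !mulmxDr -!scalemxAl -!scalemxAr.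
rewrite ![fun_of_matrix (_ + _) _ _]mxE ![fun_of_matrix (_ *: _) _ _]mxE yv.
by field.
Qed.

Lemma derive_wsum a x v : (forall j, Q j \is symmetricmx) ->
  'D_v (wsum Q xf a) x = (v^T *m (A a *m x - b a)) 0 0.
Proof.
move=> sQ; set L := RHS.
have LE : L = \sum_(j < m) a 0 j * (v^T *m Q j *m (x - xf j)) 0 0.
  rewrite /L /A /b mulmx_suml -sumrB mulmx_sumr summxE.
  apply: eq_bigr => j _.
  by rewrite -scalemxAl -scalerBr -mulmxBr -scalemxAr mulmxA mxE.
apply: cvg_lim => //.
(* By [quadf_shift], for [h != 0] the difference quotient is exactly the affine function
   [L + h * C], whose limit at 0 is [L]. *)
pose C := \sum_(j < m) a 0 j * quadf (Q j) 0 v.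
apply: (cvg_trans (near_eq_cvg (f := fun h : R => L + h * C) _)).
  near=> h; have h0 : h != 0 by near: h; exact: nbhs_dnbhs_neq.
  have -> : (wsum Q xf a \o shift x) (h *: v) - wsum Q xf a x =
      h * (L + h * C).
    rewrite /= /wsum -sumrB LE mulrDr !mulr_sumr -big_split /=.
    by apply: eq_bigr => j _; rewrite quadf_shift //; ring.
  by rewrite /GRing.scale /= mulKf.
suff : L + h * C @[h --> (0 : R)^'] --> L + 0 * C by rewrite mul0r addr0.
apply: cvgD; first exact: cvg_cst.
apply: cvgMr_tmp; exact: cvg_within.
Unshelve. all: by end_near.
Qed.

Lemma gradient_wsum a x : (forall j, Q j \is symmetricmx) ->
  gradient (wsum Q xf a) x = A a *m x - b a.
Proof.
move=> sQ; apply/colP => i; rewrite mxE derive_wsum // trmx_delta -rowE.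
by rewrite mxE.
Qed.

(** A nonzero left kernel vector [v] would make the weighted sum of the positive numbers
    [v *m Q j *m v^T] vanish. With nonnegative weights this forces every weight to be 0,
    contradicting that they sum to 1. *)
Lemma unitmx_wsum a : (forall j, spd (Q j)) -> simplex a -> A a \in unitmx.
Proof.
move=> hQ [a0 a1]; rewrite unitmxE unitfE; apply/det0P => -[v v0 vA].
have q0 j : 0 < (v *m Q j *m v^T) 0 0.
  by have [_ /(_ v^T)] := hQ j; rewrite trmxK; apply; rewrite trmx_eq0.
have : \sum_j a 0 j * (v *m Q j *m v^T) 0 0 = 0.
  have : (v *m A a *m v^T) 0 0 = 0 by rewrite vA mul0mx mxE.
  rewrite /A mulmx_sumr mulmx_suml summxE => vAv0; rewrite -[RHS]vAv0.
  apply: eq_bigr => j _.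
  by rewrite -scalemxAr -scalemxAl [RHS]mxE.
move/eqP; rewrite psumr_eq0; last by move=> j _; rewrite mulr_ge0// ltW.
move=> /allP az; move: a1; rewrite big1 => [/eqP|j _].
  by rewrite eq_sym oner_eq0.
have := az j (mem_index_enum _); rewrite mulf_eq0 (gt_eqF (q0 j)) orbF.
by move/eqP.
Qed.

Lemma compact_simplex : compact (@simplex R m).
Proof.
apply: (@subclosed_compact _ _
  [set v : 'rV[R]_m | forall i, `[0, 1]%classic (v ord0 i)]).
- rewrite /simplex; apply: closedI.
    have -> : (fun a : 'rV[R]_m => forall i, 0 <= a 0 i) =
        \bigcap_i [set a : 'rV[R]_m | 0 <= a 0 i].
      by apply/seteqP; split=> a h // i; have := h i; exact.
    apply: closed_bigI => i _.
    apply: (closed_comp _ (@closed_ge R 0)) => a _.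
    exact: coord_continuous.
  apply: (closed_comp (f := fun a : 'rV[R]_m => \sum_i a 0 i) _
    (@closed_eq R 1)) => a _.
  by apply: (@cvg_sumr R _ (nbhs a)) => i _; exact: coord_continuous.
- by apply: (@rV_compact _ _ (fun=> `[0 : R, 1]%classic)) => i;
  exact: segment_compact.
(* The upper bound holds because the remaining coordinates are nonnegative and the total is 1. *)
- move=> a [a0 a1] i /=; rewrite in_itv /= a0 /= -a1 (bigD1 i) //= lerDl.
  by apply: sumr_ge0.
Qed.

Lemma cvg_weighted_sum (p q : nat) (M : 'I_m -> 'M[R]_(p, q)) a :
  \sum_(j < m) t 0 j *: M j @[t --> a] --> \sum_(j < m) a 0 j *: M j.
Proof.
apply: cvg_mx => i k; rewrite summxE.
under eq_cvg => t do rewrite summxE.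
apply: cvg_sumr => j _; rewrite mxE.
under eq_cvg => t do rewrite mxE.
by apply: cvgMr_tmp; exact: coord_continuous.
Qed.

Lemma compact_solution_set : (forall j, spd (Q j)) ->
  compact [set p : 'cV[R]_n * 'rV[R]_m |
    simplex p.2 /\ A p.2 *m p.1 = b p.2].
Proof.
move=> hQ.
have -> : [set p : 'cV[R]_n * 'rV[R]_m | simplex p.2 /\ A p.2 *m p.1 = b p.2] =
    (fun a => (invmx (A a) *m b a, a)) @` (@simplex R m).
  apply/seteqP; split=> [[x a] /= [sa Ax]|_ [a sa <-]] /=.
    by exists a => //; rewrite -Ax mulKmx // unitmx_wsum.
  by split=> //; rewrite mulKVmx // unitmx_wsum.
apply: continuous_compact compact_simplex.
(* Continuity is checked only at points of the simplex, where [A a] is known to be invertible. *)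
apply: continuous_in_subspaceT => a; rewrite inE => sa.
apply: (@cvg_pair _ _ _ (nbhs a) (nbhs (invmx (A a) *m b a)) (nbhs a));
  last exact: cvg_id.
apply: cvg_mulmx; last exact: cvg_weighted_sum.
apply: cvg_invmx; first exact: unitmx_wsum.
exact: cvg_weighted_sum.
Qed.

End WeightedQuadratics.

Theorem mainTheorem2 (R : realType) (n m : nat) (hn : (1 <= n)%N)
    (hm : (1 <= m)%N) (Q : 'I_m -> 'M[R]_n) (xf : 'I_m -> 'cV[R]_n)
    (hQ : forall j, spd (Q j)) :
  Ghat Q xf =
    [set p : 'cV[R]_n * 'rV[R]_m | simplex p.2 /\
      (\sum_(j < m) p.2 0 j *: Q j) *m p.1 =
        \sum_(j < m) p.2 0 j *: (Q j *m xf j)] /\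
  compact (Ghat Q xf).
Proof.
have E : Ghat Q xf = [set p : 'cV[R]_n * 'rV[R]_m | simplex p.2 /\
      (\sum_(j < m) p.2 0 j *: Q j) *m p.1 =
        \sum_(j < m) p.2 0 j *: (Q j *m xf j)].
  have sQ j : Q j \is symmetricmx by case: (hQ j).
  apply/seteqP; split=> -[x a] [sa /= h]; split=> //=.
    by apply/eqP; rewrite -subr_eq0 -gradient_wsum // h.
  by rewrite gradient_wsum // h subrr.
by split=> //; rewrite E; exact: compact_solution_set.
Qed.
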